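(* Let $k_n\in\mathbb{N}$ for all $n\in\mathbb{N}$, let $\{\zeta_{n,k}:1\le k\le k_n,\ n\in\mathbb{N}\}$ be non-negative integer-valued random variables, and let $p_{n,k}\in[0,1]$ for $1\le k\le k_n$, $n\in\mathbb{N}$. Assume that, as $n\to\infty$, (i) $\sum_{k=1}^{k_n}p_{n,k}\,\mathsf{E}\zeta_{n,k}\to\lambda$ for some $\lambda\ge 0$; (ii) $\sum_{k=1}^{k_n}(p_{n,k}\,\mathsf{E}\zeta_{n,k})^2\to 0$; (iii) $\sum_{k=1}^{k_n}p_{n,k}^2\,\mathsf{E}\zeta_{n,k}(\zeta_{n,k}-1)\to 0$. Then the convolution $\mathrm{Bi}(\mathcal{L}(\zeta_{n,1}),p_{n,1})*\cdots*\mathrm{Bi}(\mathcal{L}(\zeta_{n,k_n}),p_{n,k_n})$ converges weakly to the Poisson distribution $\mathrm{Po}(\lambda)$ as $n\to\infty$.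
   Context: $\mathcal{L}(\zeta)$ denotes the distribution of a random variable $\zeta$, and $*$ denotes convolution of probability measures. For a probability measure $\mu$ on $\mathbb{Z}_+$ and $p\in[0,1]$, the mixture of binomial distributions $\mathrm{Bi}(\mu,p)$ is the probability measure on $\mathbb{Z}_+$ given by $\mathrm{Bi}(\mu,p)\{j\}:=\sum_{\ell=j}^\infty\binom{\ell}{j}p^j(1-p)^{\ell-j}\mu\{\ell\}$, $j\in\mathbb{Z}_+$ (with $0^0=1$). $\mathrm{Po}(\lambda)$ is the Poisson distribution with mean $\lambda$; $\mathrm{Po}(0)$ is the Dirac measure concentrated at $0$. *)

(* Defs.v *)
From HB Require Import structures.
From mathcomp Require Import all_boot all_order all_algebra.
From mathcomp Require Import all_classical all_reals all_analysis.
Import Order.TTheory GRing.Theory Num.Theory.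
Import numFieldNormedType.Exports.

Set Implicit Arguments.
Unset Strict Implicit.
Unset Printing Implicit Defensive.

Local Open Scope classical_set_scope.
Local Open Scope ring_scope.
Local Open Scope ereal_scope.

Definition binomial_mixture_pmf (R : realType) (mu : probability nat R)
    (p : R) (j : nat) : \bar R :=
  \sum_(j <= l <oo) (binomial_pmf l p j)%:E * mu [set l].

(* As for binomial_prob, the value outside 0 <= p <= 1 is a dummy. *)
Definition binomial_mixture (R : realType) (mu : probability nat R) (p : R)
    : set nat -> \bar R :=
  fun A => if (0 <= p <= 1)%R then
    \esum_(j in A) binomial_mixture_pmf mu p j else \d_0%N A.

Section binomial_mixture_probability.
Context (R : realType) (mu : probability nat R) (p : R).

Local Notation Bi := (binomial_mixture mu p).

Lemma binomial_mixture_pmf_ge0 j : (0 <= p <= 1)%R ->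
  0 <= binomial_mixture_pmf mu p j.
Proof.
move=> p01; apply: nneseries_ge0 => l _ _.
by rewrite mule_ge0// lee_fin binomial_pmf_ge0.
Qed.

Let Bi0 : Bi set0 = 0.
Proof. by rewrite /Bi measure0; case: ifPn => //; rewrite esum_set0. Qed.

Let Bi_ge0 A : 0 <= Bi A.
Proof.
rewrite /Bi; case: ifPn => // p01; apply: esum_ge0 => /= j _.
exact: binomial_mixture_pmf_ge0.
Qed.

Let Bi_sigma_additive : semi_sigma_additive Bi.
Proof.
move=> F mF tF mUF; rewrite /Bi; case: ifPn => p01; last first.
  exact: measure_semi_sigma_additive.
apply: cvg_toP.
  apply: ereal_nondecreasing_is_cvgn => a b ab.
  apply: lee_sum_nneg_natr => // k _ _.
  by apply: esum_ge0 => /= j _; exact: binomial_mixture_pmf_ge0.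
by rewrite nneseries_sum_bigcup// => i; exact: binomial_mixture_pmf_ge0.
Qed.

HB.instance Definition _ := isMeasure.Build _ _ _ Bi
  Bi0 Bi_ge0 Bi_sigma_additive.

Let Bi_setT : Bi [set: _] = 1.
Proof.
rewrite /Bi; case: ifPn => [p01|_]; last by rewrite probability_setT.
have b0 l j : 0 <= (binomial_pmf l p j)%:E.
  by rewrite lee_fin binomial_pmf_ge0.
rewrite -nneseries_esumT; last by move=> j; exact: binomial_mixture_pmf_ge0.
transitivity (\sum_(j <oo) \sum_(l <oo) (binomial_pmf l p j)%:E * mu [set l]).
  apply: eq_eseriesr => j _; rewrite /binomial_mixture_pmf.
  rewrite (@nneseries_split _ (fun l => (binomial_pmf l p j)%:E * mu [set l])
    0%N j); last by move=> l _; rewrite mule_ge0.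
  rewrite add0n big_nat big1 ?add0e// => l /andP[_ lj].
  by rewrite /binomial_pmf bin_small// mulr0n mul0e.
rewrite nneseries_interchange; last by move=> *; exact: mule_ge0 (b0 _ _) _.
transitivity (\sum_(l <oo) mu [set l]).
  apply: eq_eseriesr => l _.
  rewrite -[mu [set l]]fineK ?fin_num_measure//.
  under eq_eseriesr do rewrite muleC.
  rewrite nneseriesZl; last by move=> j _; exact: b0.
  rewrite nneseries_esumT; last by move=> j; exact: b0.
  have := @probability_setT _ _ _ (binomial_prob l p).
  by rewrite /= /binomial_prob p01 => ->; rewrite mule1.
rewrite -(@probability_setT _ _ _ mu) -[in RHS](image_id [set: nat]).
rewrite -bigcup_imset1 measure_semi_bigcup//.
by move=> i j _ _ [x [/= <- <-]].
Qed.

HB.instance Definition _ := @Measure_isProbability.Build _ _ R Bi Bi_setT.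

End binomial_mixture_probability.

Definition nat_add (x : nat * nat) : nat := (x.1 + x.2)%N.

Lemma measurable_nat_add : measurable_fun [set: nat * nat] nat_add.
Proof. by apply: measurable_realfun.measurable_fun_addn. Qed.

HB.instance Definition _ := isMeasurableFun.Build _ _ _ _ nat_add
  measurable_nat_add.

Definition convolution (R : realType) (mu nu : probability nat R) :
    probability nat R :=
  distribution (mu \x nu) nat_add.

(* \d_0 is neutral for convolution. *)
Definition convolutions (R : realType) (m : nat)
    (mu : 'I_m -> probability nat R) : probability nat R :=
  \big[@convolution R / (\d_0%N : probability nat R)]_(i < m) mu i.

(* The second argument of poisson_prob is unused; rate 0 gives \d_0. *)
Definition Poisson (R : realType) (lambda : R) : probability nat R :=
  poisson_prob lambda 0%N.

(* nat carries the discrete topology, so every f is in fact continuous. *)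
Definition converges_weakly (R : realType) (mu_ : nat -> probability nat R)
    (mu : probability nat R) : Prop :=
  forall f : nat -> R, continuous f -> bounded_fun f ->
    \int[mu_ n]_x (f x)%:E @[n --> \oo] --> \int[mu]_x (f x)%:E.

(* Main.v *)
(* Lindeberg's replacement method.  For |f| <= M the remainder
   f x - f 0 - x (f 1 - f 0) is at most 3 M x (x - 1), so two laws on nat with
   the same mean and with second factorial moments s and t have expectations
   of f within 3 M (s + t) of each other.  The r-th factorial moment of
   Bi(L(zeta), p) is p^r E[zeta]_r and that of Po(m) is m^r, which allows the
   factors Bi(L(zeta_i), p_i) to be exchanged for Po(m_i), m_i = p_i E zeta_i;
   the errors add up under convolution to
   3 M sum_i (p_i^2 E[zeta_i]_2 + m_i^2), which tends to 0.  Finally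
   Po(m_1) * ... * Po(m_k) = Po(m_1 + ... + m_k) is Lipschitz in its rate. *)

Require Import Defs.
From mathcomp Require Import all_boot all_order all_algebra.
From mathcomp Require Import all_classical all_reals all_analysis.
From mathcomp Require Import ring lra.
Import Order.TTheory GRing.Theory Num.Theory.
Import numFieldNormedType.Exports.

Set Implicit Arguments.
Unset Strict Implicit.
Unset Printing Implicit Defensive.

Local Open Scope classical_set_scope.
Local Open Scope ring_scope.
Local Open Scope ereal_scope.

(** * Integrals against measures on [nat] as series *)

Lemma ge0_integral_nat (R : realType) (mu : {measure set nat -> \bar R})
    (f : nat -> \bar R) : (forall j, 0 <= f j) ->
  \int[mu]_x f x = \sum_(j <oo) f j * mu [set j].
Proof.
move=> f0; rewrite -[X in integral _ X _](image_id [set: nat]) -bigcup_imset1.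
rewrite ge0_integral_bigcup//; last by move=> i j _ _ [x [/= <- <-]].
apply: eq_eseriesr => j _.
rewrite (eq_integral (cst (f j))); last by move=> x /set_mem ->.
exact: integral_cst.
Qed.

Lemma eq_measure_nat (R : realType) (mu nu : {measure set nat -> \bar R}) :
  (forall j, mu [set j] = nu [set j]) -> mu =1 nu.
Proof.
move=> munu A.
have E (m : {measure set nat -> \bar R}) : m A = \int[m]_x (\1_A x)%:E.
  by rewrite integral_indic// setIT.
rewrite !E !ge0_integral_nat//.
by apply: eq_eseriesr => j _; rewrite munu.
Qed.

(** * Factorial moments of binomial mixtures and of Poisson laws *)

Lemma binomial_prob_set1 (R : realType) (n : nat) (p : R) (j : nat) :
  (0 <= p <= 1)%R -> binomial_prob n p [set j] = (binomial_pmf n p j)%:E.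
Proof.
by move=> p01; rewrite /binomial_prob p01 esum_set1// lee_fin binomial_pmf_ge0.
Qed.

Lemma binomial_mixture_set1 (R : realType) (mu : probability nat R) (p : R)
    (j : nat) : (0 <= p <= 1)%R ->
  binomial_mixture mu p [set j] = binomial_mixture_pmf mu p j.
Proof.
move=> p01; rewrite /binomial_mixture p01 esum_set1//.
exact: binomial_mixture_pmf_ge0.
Qed.

(** [Bi(mu, p)] arises by drawing [l] from [mu] and then a binomial variable with parameters [l],
    [p]. Since [f] is non-negative, this is Tonelli for a double series. *)
Lemma integral_binomial_mixture (R : realType) (mu : probability nat R) (p : R)
    (f : nat -> R) : (0 <= p <= 1)%R -> (forall j, (0 <= f j)%R) ->
  \int[binomial_mixture mu p]_x (f x)%:E =
  \int[mu]_l \int[binomial_prob l p]_x (f x)%:E.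
Proof.
move=> p01 f0.
have b0 l j : 0 <= (binomial_pmf l p j)%:E :> \bar R.
  by rewrite lee_fin binomial_pmf_ge0.
have f0E j : 0 <= (f j)%:E by rewrite lee_fin.
rewrite [LHS]ge0_integral_nat// [RHS]ge0_integral_nat; last first.
  by move=> l; exact: integral_ge0.
(* The inner series over [l >= j] is extended to all [l], the added binomial weights being zero; the
   ranges become independent and the sums can be swapped. *)
transitivity (\sum_(j <oo) \sum_(l <oo)
    (f j)%:E * ((binomial_pmf l p j)%:E * mu [set l])).
  apply: eq_eseriesr => j _.
  rewrite [X in _ * X](binomial_mixture_set1 _ _ p01).
  rewrite nneseriesZl; last by move=> l _; exact: mule_ge0.
  rewrite /binomial_mixture_pmf.
  rewrite [in RHS](@nneseries_split _
    (fun l => (binomial_pmf l p j)%:E * mu [set l]) 0%N j); last first.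
    by move=> l _; exact: mule_ge0.
  rewrite add0n big_nat big1 ?add0e// => l /andP[_ lj].
  by rewrite /binomial_pmf bin_small// mulr0n mul0e.
rewrite nneseries_interchange; last first.
  by move=> j l; do 2 apply: mule_ge0 => //.
apply: eq_eseriesr => l _.
rewrite ge0_integral_nat// [RHS]muleC.
rewrite -[X in _ = X * _]fineK ?fin_num_measure//.
rewrite -nneseriesZl; last by move=> j _; rewrite mule_ge0.
apply: eq_eseriesr => j _.
rewrite fineK ?fin_num_measure//.
by rewrite [X in _ = _ * (_ * X)]binomial_prob_set1// muleA muleC.
Qed.

(** Multiplied by [j! (n - j)!], both sides become [(n + r)!]. This moves the falling factorial out
    of the binomial sum. *)
Lemma bin_ffact_shift (n r j : nat) : (j <= n)%N ->
  ('C(n + r, j + r) * (j + r) ^_ r = (n + r) ^_ r * 'C(n, j))%N.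
Proof.
move=> jn.
have Hf : (0 < j`! * (n - j)`!)%N by rewrite muln_gt0 !fact_gt0.
apply/eqP; rewrite -(eqn_pmul2r Hf); apply/eqP.
have H1 : ('C(n + r, j + r) * ((j + r)`! * (n - j)`!) = (n + r)`!)%N.
  by rewrite -[in RHS](@bin_fact (n + r) (j + r)) ?leq_add2r// subnDr.
have H2 : ((j + r) ^_ r * j`! = (j + r)`!)%N.
  by rewrite -[RHS](@ffact_fact _ r) ?leq_addl// addnK.
have H3 : ((n + r) ^_ r * n`! = (n + r)`!)%N.
  by rewrite -[RHS](@ffact_fact _ r) ?leq_addl// addnK.
rewrite -[RHS]mulnA bin_fact// H3 -H1 -H2.
by rewrite !mulnA.
Qed.

(** Terms of index below [r] vanish. With [n = r + m], shifting the index by [r] leaves the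
    expansion of [((1 - p) + p) ^ m = 1]. *)
Lemma integral_ffact_binomial (R : realType) (n r : nat) (p : R) :
  (0 <= p <= 1)%R ->
  \int[binomial_prob n p]_x ((x ^_ r)%:R)%:E = ((n ^_ r)%:R * p ^+ r)%:E.
Proof.
move=> /andP[p0 p1]; rewrite (@integral_binomial _ n p p0 p1)//.
under eq_bigr do rewrite -EFinM.
rewrite sumEFin; congr EFin => /=.
have [nr|rn] := ltnP n r.
  rewrite ffact_small// mul0r big1// => i _.
  by rewrite ffact_small ?mulr0// (leq_trans _ nr).
have [m ->] : exists m, n = (r + m)%N by exists (n - r)%N; rewrite subnKC.
rewrite -addnS big_split_ord/= big1 ?add0r; last first.
  by move=> i _; rewrite ffact_small ?mulr0.
under eq_bigr => i _.
  rewrite subnDl -[(_ *+ 'C(_, _))%R]mulr_natr -mulrA -natrM ![(r + _)%N]addnC.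
  rewrite bin_ffact_shift; last by rewrite -ltnS.
  rewrite (_ : _ * _ = ((m + r) ^_ r)%:R * p ^+ r *
    ((1 - p) ^+ (m - i) * p ^+ i *+ 'C(m, i)))%R; last first.
    by rewrite natrM exprD /unstable.onem -[(_ *+ 'C(_, _))%R]mulr_natr; ring.
  over.
by rewrite -mulr_sumr -exprDn subrK expr1n mulr1 addnC.
Qed.

Lemma integral_ffact_binomial_mixture (R : realType) (mu : probability nat R)
    (p : R) (r : nat) : (0 <= p <= 1)%R ->
  \int[binomial_mixture mu p]_x ((x ^_ r)%:R)%:E =
  (p ^+ r)%:E * \int[mu]_x ((x ^_ r)%:R)%:E.
Proof.
move=> p01; have /andP[p0 _] := p01; rewrite integral_binomial_mixture//.
rewrite -ge0_integralZl//; last by rewrite lee_fin exprn_ge0.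
by apply: eq_integral => l _; rewrite integral_ffact_binomial// mulrC.
Qed.

(** Rate 0 is included: the default branch [\d_0] of [poisson_prob] agrees with the formula because
    [0 ^ 0 = 1]. *)
Lemma Poisson_set1 (R : realType) (a : R) (j : nat) : (0 <= a)%R ->
  Poisson a [set j] = (a ^+ j / j`!%:R * expR (- a))%:E.
Proof.
rewrite /Poisson/= /poisson_prob le_eqVlt => /predU1P[<-|a0].
  rewrite ltxx diracE oppr0 expR0 mulr1.
  case: j => [|j]; first by rewrite mem_set// fact0 divr1.
  by rewrite memNset// expr0n/= mul0r.
by rewrite a0 esum_set1 ?lee_fin ?poisson_pmf_ge0// /poisson_pmf a0.
Qed.

(** After a shift by [r] the falling factorial cancels against [(j + r)!], which leaves [a ^ r]
    times the total mass. *)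
Lemma integral_ffact_Poisson (R : realType) (a : R) (r : nat) : (0 <= a)%R ->
  \int[Poisson a]_x ((x ^_ r)%:R)%:E = (a ^+ r)%:E.
Proof.
move=> a0; rewrite ge0_integral_nat//.
rewrite (nneseries_split 0 r); last by move=> j _; rewrite mule_ge0.
rewrite add0n big_nat big1 ?add0e; last first.
  by move=> j /andP[_ jr]; rewrite ffact_small// mul0e.
rewrite -(@nneseries_addn _ _ r); last by move=> j; rewrite mule_ge0.
transitivity (\sum_(j <oo) (a ^+ r)%:E * Poisson a [set j]).
  apply: eq_eseriesr => j _; rewrite [X in _ * X]Poisson_set1//.
  rewrite [X in _ = _ * X]Poisson_set1// -!EFinM; congr EFin.
  have jr : ((j + r)`! = (j + r) ^_ r * j`!)%N.
    by rewrite -[LHS](@ffact_fact _ r) ?leq_addl// addnK.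
  have h1 : (((j + r) ^_ r)%:R != 0 :> R)%R.
    by rewrite pnatr_eq0 -lt0n ffact_gt0 leq_addl.
  have h2 : ((j`!)%:R != 0 :> R)%R by rewrite pnatr_eq0 -lt0n fact_gt0.
  by rewrite jr natrM exprD; field; rewrite h1 h2.
rewrite nneseriesZl//.
rewrite [X in _ * X](_ : _ = 1) ?mule1//.
transitivity (\int[Poisson a]_x 1).
  by rewrite ge0_integral_nat//; under [in RHS]eq_eseriesr do rewrite mul1e.
by rewrite integral_cst// mul1e; exact: probability_setT.
Qed.

(** * Means of bounded functions and their behaviour under convolution *)

(* A fine integral, only meaningful for integrable f. *)
Definition mean (R : realType) (mu : {measure set nat -> \bar R})
    (f : nat -> R) : R :=
  \int[mu]_x f x.

(** The bound is uniform over a class of test functions that is stable under translation and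
    averaging; this is what lets errors add under convolution. *)
Definition mean_close (R : realType) (M : R)
    (mu nu : {measure set nat -> \bar R}) (e : R) : Prop :=
  forall f : nat -> R, (forall x, `|f x| <= M)%R ->
    (`|mean mu f - mean nu f| <= e)%R.

Lemma mean_cst (R : realType) (mu : probability nat R) (c : R) :
  mean mu (cst c) = c.
Proof.
rewrite /mean Rintegral_cst// (_ : _ setT = 1) ?mulr1//.
exact: probability_setT.
Qed.

Lemma mean_dirac (R : realType) (a : nat) (f : nat -> R) :
  mean (\d_a : probability nat R) f = f a.
Proof. by rewrite /mean /Rintegral integral_dirac// diracT mul1e. Qed.

Lemma eq_mean (R : realType) (mu nu : probability nat R) (f : nat -> R) :
  mu =1 nu -> mean mu f = mean nu f.
Proof.
move=> E; rewrite /mean /Rintegral; congr (fine _).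
by apply: eq_measure_integral => A _ _; exact: E.
Qed.

Lemma bounded_integrable (R : realType) (d : measure_display)
    (T : measurableType d) (mu : probability T R) (M : R) (f : T -> R) :
  measurable_fun setT f -> (forall x, `|f x| <= M)%R ->
  mu.-integrable setT (EFin \o f).
Proof.
move=> mf fM; apply: measurable_bounded_integrable => //.
  by apply: (@le_lt_trans _ _ 1); [exact: probability_le1|exact: ltry].
by exists M; split=> [|y My x _]; [exact: num_real|apply: le_trans (ltW My)].
Qed.

Lemma mean_le (R : realType) (mu : probability nat R) (f : nat -> R) (e : R) :
  (forall x, `|f x| <= e)%R -> (`|mean mu f| <= e)%R.
Proof.
move=> fe; have intf := @bounded_integrable _ _ _ mu _ _ (fun _ _ _ => I) fe.
apply: le_trans (le_normr_Rintegral _ intf) _ => //.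
rewrite -(mean_cst mu e); apply: le_Rintegral => //.
- exact: integrable_norm.
- exact: finite_measure_integrable_cst.
Qed.

Section bounded.
Context (R : realType) (M : R).
Implicit Types (mu nu : probability nat R) (f g : nat -> R).

Lemma mean_convolution mu nu f : (forall x, `|f x| <= M)%R ->
  mean (convolution mu nu) f =
  mean mu (fun x => mean nu (fun y => f (x + y)%N)).
Proof.
move=> fM.
have mf : measurable_fun [set: nat * nat] (f \o nat_add).
  by apply: measurableT_comp measurable_nat_add.
have intf : (mu \x nu).-integrable setT (EFin \o (f \o nat_add)).
  exact: (bounded_integrable (mu \x nu : probability _ R) mf (fun=> fM _)).
rewrite /mean /Rintegral; congr fine.
rewrite integral_distribution// -integral12_prod_meas1//.
apply: eq_integral => x _ /=.
rewrite fineK//; apply: integrable_fin_num => //.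
by apply: (@bounded_integrable _ _ _ _ M).
Qed.

(** The factors are exchanged one at a time, through [mu'] convolved with [nu]. The average [g] of
    the translates of [f] is again bounded by [M], so the first hypothesis applies to it; the second
    bounds [g - g'] pointwise. *)
Lemma mean_close_convolution mu mu' nu nu' (e e' : R) :
  mean_close M mu mu' e -> mean_close M nu nu' e' ->
  mean_close M (convolution mu nu) (convolution mu' nu') (e + e').
Proof.
move=> hmu hnu f fM.
rewrite !mean_convolution//.
set g := fun x => mean nu (fun y => f (x + y)%N).
set g' := fun x => mean nu' (fun y => f (x + y)%N).
have gM x : (`|g x| <= M)%R by exact: mean_le.
have g'M x : (`|g' x| <= M)%R by exact: mean_le.
rewrite -(subrKA (mean mu' g)) (le_trans (ler_normD _ _))// lerD//.
  exact: hmu.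
rewrite -RintegralB//; [|exact: (@bounded_integrable _ _ _ _ M)..].
by apply: mean_le => x; exact: hnu.
Qed.
End bounded.

(** * First-order expansion and comparison by moments *)

Lemma ge0_integrable_nat (R : realType) (mu : {measure set nat -> \bar R})
    (f : nat -> R) (a : R) : (forall x, (0 <= f x)%R) ->
  \int[mu]_x (f x)%:E = a%:E -> mu.-integrable setT (EFin \o f).
Proof.
move=> f0 fa; apply/integrableP; split => //.
by under eq_integral do rewrite /= ger0_norm//; rewrite fa ltry.
Qed.

Section taylor.
Context (R : realType) (M : R).
Implicit Types (mu nu : probability nat R) (f : nat -> R).

(** The remainder vanishes at 0 and 1. For [x >= 2] the triangle inequality bounds it by
    [2 M + 2 M x], and [3 x (x - 1) - 2 x - 2 = (3 x + 1) (x - 2) >= 0]. *)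
Lemma taylor_nat f x : (forall x, `|f x| <= M)%R ->
  (`|f x - f 0%N - x%:R * (f 1%N - f 0%N)| <= 3 * M * (x ^_ 2)%:R)%R.
Proof.
move=> fM; have M0 : (0 <= M)%R := le_trans (normr_ge0 _) (fM 0%N).
case: x => [|[|x]].
- by rewrite mul0r subr0 subrr normr0 mulr0.
- by rewrite mul1r subrr normr0 mulr0.
have := fM 0%N; have := fM 1%N; have := fM x.+2.
rewrite !ler_norml => /andP[a1 a2] /andP[b1 b2] /andP[c1 c2].
rewrite ffactnS ffactn1 natrM -[x.+2.-1]/x.+1.
have -> : (x.+2%:R = x%:R + 2 :> R)%R by rewrite -addn2 natrD.
have -> : (x.+1%:R = x%:R + 1 :> R)%R by rewrite -addn1 natrD.
have : (0 <= x%:R :> R)%R by [].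
(* Here [t] is the argument minus 2. The products below are the nonlinear facts from which the goal
   follows linearly. *)
move: (x%:R)%R => t t0.
have h1 : (0 <= t * (M - f 1%N))%R by rewrite mulr_ge0// subr_ge0.
have h2 : (0 <= t * (M + f 1%N))%R by rewrite mulr_ge0// -lerBlDl sub0r.
have h3 : (0 <= t * (M - f 0%N))%R by rewrite mulr_ge0// subr_ge0.
have h4 : (0 <= t * (M + f 0%N))%R by rewrite mulr_ge0// -lerBlDl sub0r.
have h5 : (0 <= M * t * t)%R by rewrite !mulr_ge0.
have h6 : (0 <= M * t)%R by rewrite mulr_ge0.
apply/andP; split; lra.
Qed.

Lemma mean_taylor mu f (m s : R) : (forall x, `|f x| <= M)%R ->
  \int[mu]_x ((x ^_ 1)%:R)%:E = m%:E -> \int[mu]_x ((x ^_ 2)%:R)%:E = s%:E ->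
  (`|mean mu f - (f 0%N + m * (f 1%N - f 0%N))| <= 3 * M * s)%R.
Proof.
move=> fM h1 h2.
have M0 : (0 <= M)%R := le_trans (normr_ge0 _) (fM 0%N).
have i1 : mu.-integrable setT (EFin \o fun x : nat => (x ^_ 1)%:R : R).
  exact: ge0_integrable_nat h1.
have i2 : mu.-integrable setT (EFin \o fun x : nat => (x ^_ 2)%:R : R).
  exact: ge0_integrable_nat h2.
have intf : mu.-integrable setT (EFin \o f).
  exact: (@bounded_integrable _ _ _ _ M).
have ic (c : R) : mu.-integrable setT (EFin \o cst c).
  exact: finite_measure_integrable_cst.
have il : mu.-integrable setT
    (EFin \o fun x : nat => (f 1%N - f 0%N) * (x ^_ 1)%:R : R)%R.
  exact: (integrableZl measurableT (f 1%N - f 0%N) i1).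
have intfB : mu.-integrable setT (EFin \o fun x : nat => f x - f 0%N : R)%R.
  exact: (integrableB measurableT intf (ic (f 0%N))).
have ig : mu.-integrable setT (EFin \o fun x : nat =>
    (f x - f 0%N) - (f 1%N - f 0%N) * (x ^_ 1)%:R : R)%R.
  exact: (integrableB measurableT intfB il).
have ib : mu.-integrable setT
    (EFin \o fun x : nat => 3 * M * (x ^_ 2)%:R : R)%R.
  exact: (integrableZl measurableT (3 * M) i2).
rewrite (_ : (_ - _) = \int[mu]_x
    ((f x - f 0%N) - (f 1%N - f 0%N) * (x ^_ 1)%:R))%R; last first.
  rewrite RintegralB// RintegralB//; last exact: (ic (f 0%N)).
  rewrite RintegralZl// [X in (_ - X - _)%R](mean_cst mu).
  rewrite [X in (_ = _ - _ * X)%R](_ : _ = m); last by rewrite /Rintegral h1.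
  by rewrite /mean; ring.
apply: le_trans (le_normr_Rintegral _ ig) _ => //.
rewrite (_ : 3 * M * s = \int[mu]_x (3 * M * (x ^_ 2)%:R))%R; last first.
  by rewrite RintegralZl// /Rintegral h2.
apply: le_Rintegral => //; first exact: integrable_norm.
by move=> x _; rewrite ffactn1 mulrC; exact: taylor_nat.
Qed.

(** Both means are compared with the same number [c], which depends only on [f] and on the common
    first moment. *)
Lemma mean_close_moments mu nu (m s t : R) :
  \int[mu]_x ((x ^_ 1)%:R)%:E = m%:E -> \int[mu]_x ((x ^_ 2)%:R)%:E = s%:E ->
  \int[nu]_x ((x ^_ 1)%:R)%:E = m%:E -> \int[nu]_x ((x ^_ 2)%:R)%:E = t%:E ->
  mean_close M mu nu (3 * M * (s + t)).
Proof.
move=> mu1 mu2 nu1 nu2 f fM.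
rewrite mulrDr; set c := (f 0%N + m * (f 1%N - f 0%N))%R.
rewrite -(subrKA c) (le_trans (ler_normD _ _))// lerD//.
  exact: mean_taylor.
by rewrite distrC; exact: mean_taylor.
Qed.

(** [|f x - f 0| <= 2 M x] for every natural [x], and the mean of [Poisson a] is [a]. *)
Lemma mean_close_Poisson_dirac (a : R) : (0 <= a)%R ->
  mean_close M (Poisson a) (\d_0%N : probability nat R) (2 * M * a).
Proof.
move=> a0 f fM.
have M0 : (0 <= M)%R := le_trans (normr_ge0 _) (fM 0%N).
have := @integral_ffact_Poisson R a 1%N a0; rewrite expr1 => h1.
have i1 := ge0_integrable_nat (fun x => ler0n R (x ^_ 1)) h1.
have intf : (Poisson a).-integrable setT (EFin \o f).
  exact: (@bounded_integrable _ _ _ _ M).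
have ic (c : R) : (Poisson a).-integrable setT (EFin \o cst c).
  exact: finite_measure_integrable_cst.
have intfB : (Poisson a).-integrable setT
    (EFin \o fun x : nat => f x - f 0%N : R)%R.
  exact: (integrableB measurableT intf (ic (f 0%N))).
have ib : (Poisson a).-integrable setT
    (EFin \o fun x : nat => 2 * M * (x ^_ 1)%:R : R)%R.
  exact: (integrableZl measurableT (2 * M) i1).
rewrite mean_dirac.
rewrite (_ : _ - _ = \int[Poisson a]_x (f x - f 0%N))%R; last first.
  rewrite RintegralB//; last exact: (ic (f 0%N)).
  by rewrite [X in (_ = _ - X)%R](mean_cst (Poisson a)).
apply: le_trans (le_normr_Rintegral _ intfB) _ => //.
rewrite (_ : 2 * M * a = \int[Poisson a]_x (2 * M * (x ^_ 1)%:R))%R; last first.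
  by rewrite RintegralZl// /Rintegral h1.
apply: le_Rintegral => //; first exact: integrable_norm.
move=> [|x] _; first by rewrite subrr normr0 mulr0.
have := fM x.+1; have := fM 0%N; rewrite !ler_norml => /andP[? ?] /andP[? ?].
rewrite ffactn1.
have -> : (x.+1%:R = x%:R + 1 :> R)%R by rewrite -addn1 natrD.
have : (0 <= x%:R :> R)%R by [].
by move: (x%:R)%R => t t0; apply/andP; split; nra.
Qed.

End taylor.

(** * Convolutions of Poisson laws and dependence on the rate *)

Lemma convolution_set1 (R : realType) (mu nu : probability nat R) n :
  convolution mu nu [set n] =
  \sum_(i < n.+1) mu [set nat_of_ord i] * nu [set (n - i)%N].
Proof.
have -> : convolution mu nu [set n] = \int[mu]_x nu [set y | (x + y)%N = n].
  rewrite /= /pushforward /product_measure1 /=.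
  apply: eq_integral => x _ /=; congr (nu _).
  by apply/seteqP; split => y; rewrite /xsection/= ?inE ?mem_set.
rewrite ge0_integral_nat//.
rewrite (nneseries_split 0 n.+1); last by move=> j _; rewrite mule_ge0.
(* For [x > n] no [y] satisfies [x + y = n], so the series stops at [n]. *)
rewrite add0n eseries0 ?adde0; last first.
  move=> i ni _; rewrite (_ : [set _ | _] = set0) ?measure0 ?mul0e//.
  by rewrite -subset0 => y /= iyn; move: ni; rewrite -iyn ltnNge leq_addr.
rewrite big_mkord; apply: eq_bigr => i _; rewrite muleC; congr (_ * nu _).
apply/seteqP; split => y /=.
  by move/(congr1 (subn^~ (nat_of_ord i))); rewrite addKn.
by move=> ->; rewrite subnKC// -ltnS.
Qed.

(** On singletons this is the binomial expansion of [(a + b) ^ n]. *)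
Lemma Poisson_convolution (R : realType) (a b : R) : (0 <= a)%R -> (0 <= b)%R ->
  convolution (Poisson a) (Poisson b) =1 Poisson (a + b).
Proof.
move=> a0 b0; apply: eq_measure_nat => n.
rewrite [LHS]convolution_set1 [RHS]Poisson_set1 ?addr_ge0//.
under eq_bigr do
  rewrite [X in X * _]Poisson_set1// [X in _ * X]Poisson_set1// -EFinM.
rewrite sumEFin; congr EFin.
rewrite opprD expRD addrC exprDn !mulr_suml; apply: eq_bigr => i _.
have ni : (i <= n)%N by rewrite -ltnS.
have f1 k : ((k`!)%:R != 0 :> R)%R by rewrite pnatr_eq0 -lt0n fact_gt0.
rewrite -mulr_natr -(bin_fact ni) !natrM.
by field; rewrite !f1 pnatr_eq0 -lt0n bin_gt0.
Qed.

Lemma mean_close_refl (R : realType) (M : R) (mu : probability nat R) :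
  mean_close M mu mu 0.
Proof. by move=> f _; rewrite subrr normr0. Qed.

Lemma mean_close_sum_Poisson (R : realType) (M : R) (n : nat)
    (mu : 'I_n -> probability nat R) (m e : 'I_n -> R) :
  (forall i, (0 <= m i)%R) ->
  (forall i, mean_close M (mu i) (Poisson (m i)) (e i)) ->
  mean_close M (convolutions mu) (Poisson (\sum_(i < n) m i)%R)
    (\sum_(i < n) e i)%R.
Proof.
move=> m0 mue.
(* Non-negativity of the partial rate is carried through the induction, since adding Poisson rates
   requires it. *)
have [] // : ((0 <= \sum_(i < n) m i)%R /\
  mean_close M (convolutions mu) (Poisson (\sum_(i < n) m i)%R)
    (\sum_(i < n) e i)%R).
rewrite /convolutions.
apply: (@big_rec3 _ _ _ (fun (x : probability nat R) (a b : R) =>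
  (0 <= a)%R /\ mean_close M x (Poisson a) b)).
  (* The empty convolution is [\d_0], which is [Poisson 0]. *)
  split=> // f fM; rewrite (_ : mean _ f = mean (Poisson 0) f) ?subrr ?normr0//.
  by apply: eq_mean => A; rewrite /= /poisson_prob ltxx.
move=> i x a b _ [a0 xab]; split; first by rewrite addr_ge0.
move=> f fM; rewrite -(eq_mean f (Poisson_convolution (m0 i) a0)).
by apply: (mean_close_convolution (mue i) xab).
Qed.

(** For [a <= b], [Po(b)] is [Po(a)] convolved with [Po(b - a)], and [Po(a)] is [Po(a)] convolved
    with [\d_0]; only the second factors differ. *)
Lemma mean_close_Poisson (R : realType) (M : R) (a b : R) :
  (0 <= a)%R -> (0 <= b)%R ->
  mean_close M (Poisson a) (Poisson b) (2 * M * `|a - b|)%R.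
Proof.
wlog ab : a b / (a <= b)%R => [H a0 b0|a0 b0 f fM].
  have [ab|/ltW ba] := leP a b; first exact: H.
  by move=> f fM; rewrite distrC [(`|a - b|)%R]distrC; exact: H.
have ba0 : (0 <= b - a)%R by rewrite subr_ge0.
have -> : mean (Poisson b) f =
    mean (convolution (Poisson a) (Poisson (b - a)%R)) f.
  by apply: eq_mean => A; rewrite Poisson_convolution// subrKC.
have -> : mean (Poisson a) f =
    mean (convolution (Poisson a) (\d_0%N : probability nat R)) f.
  rewrite (mean_convolution _ _ fM); congr mean; apply/funext => x.
  by rewrite mean_dirac addn0.
rewrite distrC [(`|a - b|)%R]distrC (ger0_norm ba0) -[leRHS]add0r.
exact: (mean_close_convolution (@mean_close_refl _ M _)
  (@mean_close_Poisson_dirac _ M _ ba0) fM).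
Qed.

(** * Passage to the limit along the rows *)

Lemma sum_fin_num_fine (R : realType) (n : nat) (F : 'I_n -> \bar R) :
  \sum_(i < n) F i \is a fin_num -> forall i, (fine (F i))%:E = F i.
Proof.
by move=> /sum_fin_numP Ffin i; rewrite fineK// Ffin// mem_index_enum.
Qed.

Lemma integral_ffact_binomial_mixture_distribution (R : realType)
    (d : measure_display) (T : measurableType d) (P : probability T R)
    (X : {RV P >-> nat}) (p : R) (r : nat) : (0 <= p <= 1)%R ->
  \int[binomial_mixture (distribution P X) p]_x ((x ^_ r)%:R)%:E =
  (p ^+ r)%:E * 'E_P[fun w => (X w ^_ r)%:R%R].
Proof.
move=> p01; rewrite integral_ffact_binomial_mixture// unlock; congr (_ * _).
by rewrite ge0_integral_distribution.
Qed.

Theorem theorem3 (R : realType) (k : nat -> nat)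
    (hk : forall n, (0 < k n)%N)
    (d : forall n, 'I_(k n) -> measure_display)
    (T : forall (n : nat) (i : 'I_(k n)), measurableType (d n i))
    (P : forall (n : nat) (i : 'I_(k n)), probability (T n i) R)
    (zeta : forall (n : nat) (i : 'I_(k n)), {RV P n i >-> nat})
    (p : forall n, 'I_(k n) -> R)
    (hp : forall (n : nat) (i : 'I_(k n)), (0 <= p n i <= 1)%R)
    (lambda : R) (hlambda : (0 <= lambda)%R)
    (h1 : \sum_(i < k n)
            (p n i)%:E * 'E_(P n i)[fun w => (zeta n i w)%:R%R]
          @[n --> \oo] --> lambda%:E)
    (h2 : \sum_(i < k n)
            ((p n i)%:E * 'E_(P n i)[fun w => (zeta n i w)%:R%R]) ^+ 2
          @[n --> \oo] --> 0)
    (h3 : \sum_(i < k n)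
            (p n i)%:E ^+ 2 *
            'E_(P n i)[fun w => ((zeta n i w)%:R * ((zeta n i w)%:R - 1))%R]
          @[n --> \oo] --> 0) :
  converges_weakly
    (fun n => convolutions (fun i : 'I_(k n) =>
       binomial_mixture (distribution (P n i) (zeta n i)) (p n i)
         : probability nat R))
    (Poisson lambda).
Proof.
(* Boundedness gives [|f x| <= y] for every [y > M0], hence the choice [M0 + 1]. *)
move=> f _ [M0 [_ fM0]]; pose M := (M0 + 1)%R.
have fM x : (`|f x| <= M)%R by apply: fM0 => //; rewrite ltrDl.
pose b n i := binomial_mixture (distribution (P n i) (zeta n i)) (p n i).
pose m n i := (p n i)%:E * 'E_(P n i)[fun w => (zeta n i w)%:R%R].
pose s n i := (p n i)%:E ^+ 2 *
            'E_(P n i)[fun w => ((zeta n i w)%:R * ((zeta n i w)%:R - 1))%R].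
have m0 n i : 0 <= m n i.
  have /andP[p0 _] := hp n i.
  by rewrite mule_ge0// expectation_ge0.
have moment1 n i : \int[b n i]_x ((x ^_ 1)%:R)%:E = m n i.
  rewrite integral_ffact_binomial_mixture_distribution// expr1 /m.
  by under eq_fun do rewrite ffactn1.
have moment2 n i : \int[b n i]_x ((x ^_ 2)%:R)%:E = s n i.
  rewrite integral_ffact_binomial_mixture_distribution// /s -EFin_expe.
  congr (_ * expectation _ _); apply/funext => w.
  (* The falling factorial uses the truncated predecessor on [nat], the hypothesis subtraction in
     [R]; they differ only at 0, where the other factor vanishes. *)
  case: (zeta n i w) => [|z]; first by rewrite mul0r.
  by rewrite ffactnS ffactn1 natrM -[in X in (_ * (X - _))%R]addn1 natrD addrK.
(* A finite limit makes the row sums finite for large [n]; from there on each summand is a real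
   number. *)
have /fine_cvgP[fin1 cvg1] := h1.
have /fine_cvgP[_ cvg2] := h2.
have /fine_cvgP[fin3 cvg3] := h3.
have fin_f (nu : probability nat R) : \int[nu]_x (f x)%:E = (mean nu f)%:E.
  rewrite /mean fineK//; apply: integrable_fin_num => //.
  exact: (@bounded_integrable _ _ _ _ M).
rewrite fin_f; under eq_fun do rewrite fin_f.
apply: cvg_EFin; first by near=> n.
(* The first term is the cost of replacing the factors by Poisson laws, the second that of moving
   the total rate to [lambda]. *)
pose e n := (3 * M * (fine (\sum_(i < k n) s n i) +
    fine (\sum_(i < k n) m n i ^+ 2)) +
  2 * M * `|fine (\sum_(i < k n) m n i) - lambda|)%R.
have e0 : e n @[n --> \oo] --> 0%R.
  rewrite (_ : 0%R = 3 * M * (0 + 0) + 2 * M * `|lambda - lambda|)%R;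
    last first.
    by rewrite subrr normr0 !mulr0 !addr0 mulr0.
  apply: cvgD; apply: cvgMr; first exact: cvgD.
  by apply: cvg_norm; apply: cvgB => //; exact: cvg_cst.
apply: (@squeeze_cvgr _ _ _ _ (fun n => mean (Poisson lambda) f - e n)%R
  (fun n => mean (Poisson lambda) f + e n)%R).
- near=> n.
  rewrite -ler_distl.
  have /sum_fin_num_fine mE : \sum_(i < k n) m n i \is a fin_num.
    by near: n.
  have /sum_fin_num_fine sE : \sum_(i < k n) s n i \is a fin_num.
    by near: n.
  have mf0 i : (0 <= fine (m n i))%R by rewrite fine_ge0.
  have close_n i : mean_close M (b n i) (Poisson (fine (m n i)))
      (3 * M * (fine (s n i) + fine (m n i) ^+ 2)).
    apply: (@mean_close_moments _ _ _ _ (fine (m n i))).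
    - by rewrite moment1 mE.
    - by rewrite moment2 sE.
    - by rewrite integral_ffact_Poisson// expr1.
    - exact: integral_ffact_Poisson.
  have := mean_close_sum_Poisson mf0 close_n fM.
  have sum_m0 : (0 <= \sum_(i < k n) fine (m n i))%R by exact: sumr_ge0.
  have := mean_close_Poisson sum_m0 hlambda fM.
  rewrite -mulr_sumr big_split/=.
  rewrite (_ : \sum_(i < k n) fine (m n i) ^+ 2 =
    fine (\sum_(i < k n) m n i ^+ 2))%R; last first.
    rewrite -sum_fine => [|i _]; last by rewrite -mE -EFin_expe.
    by apply: eq_bigr => i _; rewrite -[in RHS]mE -EFin_expe.
  rewrite !sum_fine => [|i _|i _]; [|by rewrite -sE|by rewrite -mE].
  move=> h h'.
  (* The intermediate law is Poisson with the sum of the row means as its rate. *)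
  rewrite -(subrKA (mean (Poisson (fine (\sum_(i < k n) m n i))) f)).
  exact: le_trans (ler_normD _ _) (lerD h' h).
- rewrite -[X in _ --> X]subr0; apply: cvgB => //; exact: cvg_cst.
- rewrite -[X in _ --> X]addr0; apply: cvgD => //; exact: cvg_cst.
Unshelve. all: by end_near.
Qed.
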